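(* Let $n,r$ be nonnegative integers with $r>\lceil n/2\rceil$. Then firing from the pulse $K(n,r)$ does not terminate uniquely.
   Context: The grid complex is the tiling of the plane by unit squares (''faces''); two faces are adjacent if they share an edge, and $\mathrm{dist}(f,g)$ is the Manhattan distance between faces. A configuration $K$ assigns an integer weight $K_f$ to each face $f$, with finitely many nonzero weights; there is a marked face $f_0$ with $K_{f_0}=n$. Firing moves: (i) if $f,g$ are adjacent faces, both different from $f_0$, with $K_f\geq K_g+2$, one may fire $f$ towards $g$, decreasing $K_f$ by $1$ and increasing $K_g$ by $1$; (ii) if $g$ is adjacent to $f_0$ and $K_g<n$, one may fire from $f_0$ to $g$, increasing $K_g$ by $1$; (iii) if $g$ is adjacent to $f_0$ and $K_g>n$, one may fire from $g$ to $f_0$, decreasing $K_g$ by $1$; the weight of $f_0$ never changes. A configuration is stable if no firing move is possible. Firing from $K$ terminates uniquely if every sequence of firing moves from $K$ is finite and all maximal such sequences end at the same stable configuration. The pulse $K(n,r)$ has $K(n,r)_f=n$ if $\mathrm{dist}(f_0,f)\leq r$ and $0$ otherwise.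
   Formalization: The formal theorem assumes n ≥ 2: for n = 0 and n = 1 the pulse K(n,r) admits no firing move at all, so it is already stable and firing terminates uniquely, and the claim as stated fails there. *)

(* Defs.v *)
From HB Require Import structures.
From mathcomp Require Import all_boot all_order all_algebra.
From mathcomp Require Import finmap zify.
From Stdlib Require Import Relation_Operators Operators_Properties.

Set Implicit Arguments.
Unset Strict Implicit.
Unset Printing Implicit Defensive.

Import Order.TTheory GRing.Theory Num.Theory.
Local Open Scope fset_scope.
Local Open Scope ring_scope.

(* (x, y) stands for the unit square [x, x + 1] x [y, y + 1]. *)
Definition face : Type := (int * int)%type.

Definition adjacent (f g : face) : bool :=
  ((f.1 == g.1) && (`|f.2 - g.2| == 1)) ||
  ((f.2 == g.2) && (`|f.1 - g.1| == 1)).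

Definition dist (f g : face) : nat :=
  (absz (f.1 - g.1) + absz (f.2 - g.2))%N.

Definition config : Type := {fsfun face -> int with 0}.

(* The height n of the marked face f0 is read off as K f0; no move changes
   it. *)
Inductive fire (f0 : face) (K : config) : config -> Prop :=
| FireBetween f g :
    adjacent f g -> f != f0 -> g != f0 -> K g + 2 <= K f ->
    fire f0 K [fsfun K with f |-> K f - 1, g |-> K g + 1]
| FireFromMarked g :
    adjacent f0 g -> K g < K f0 ->
    fire f0 K [fsfun K with g |-> K g + 1]
| FireToMarked g :
    adjacent f0 g -> K f0 < K g ->
    fire f0 K [fsfun K with g |-> K g - 1].

Definition fire_star (f0 : face) : config -> config -> Prop :=
  clos_refl_trans config (fire f0).

Definition stable (f0 : face) (K : config) : Prop :=
  forall K' : config, ~ fire f0 K K'.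

(* Once infinite firing sequences are excluded, the maximal sequences are
   exactly the finite ones ending at a stable configuration. *)
Definition terminates_uniquely (f0 : face) (K : config) : Prop :=
  (forall s : nat -> config,
     s 0%N = K -> ~ (forall i : nat, fire f0 (s i) (s i.+1))) /\
  (exists L : config,
     stable f0 L /\
     forall L' : config, fire_star f0 K L' -> stable f0 L' -> L' = L).

Definition ball (f0 : face) (r : nat) : {fset face} :=
  [fset f in [seq (f0.1 + i%:Z - r%:Z, f0.2 + j%:Z - r%:Z)
                | i <- iota 0 r.*2.+1, j <- iota 0 r.*2.+1]
   | (dist f0 f <= r)%N].

Lemma in_ball (f0 : face) r (f : face) :
  (f \in ball f0 r) = (dist f0 f <= r)%N.
Proof.
rewrite /ball in_fset inE; apply: andb_idl.
rewrite /dist; case: f f0 => [x y] [a b] le_r; apply/allpairsPdep.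
have shift (c z : int) : (absz (c - z) <= r)%N ->
    absz (z - c + r%:Z) \in iota 0 r.*2.+1 /\
    z = c + (absz (z - c + r%:Z))%:Z - r%:Z.
  by rewrite mem_iota => ?; split; lia.
have [|xr xE] := shift a x; first apply: leq_trans (leq_addr _ _) le_r.
have [|yr yE] := shift b y; first apply: leq_trans (leq_addl _ _) le_r.
by exists (absz (x - a + r%:Z)), (absz (y - b + r%:Z)); rewrite -xE -yE.
Qed.

Definition pulse (f0 : face) (n r : nat) : config :=
  [fsfun f in ball f0 r => n%:Z | 0].

Lemma pulseE f0 n r f :
  pulse f0 n r f = if (dist f0 f <= r)%N then n%:Z else 0.
Proof. by rewrite fsfunE in_ball. Qed.

(* Heights 0 and 1 are degenerate: such a pulse admits no move at all, so
   non-uniqueness can only be claimed for n >= 2. *)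
Lemma pulse_le1_terminates_uniquely f0 n r :
  (n <= 1)%N -> (uphalf n < r)%N -> terminates_uniquely f0 (pulse f0 n r).
Proof.
move=> n1 nr.
have st : stable f0 (pulse f0 n r).
  have dist00 : dist f0 f0 = 0%N by rewrite /dist; lia.
  have dist01 g : adjacent f0 g -> dist f0 g = 1%N.
    by rewrite /adjacent /dist => /orP[] /andP[/eqP-> /eqP]; lia.
  have r0 : (0 < r)%N := leq_ltn_trans (leq0n _) nr.
  move=> K' [f g _ _ _|g /dist01 d1|g /dist01 d1]; rewrite !pulseE.
  - by case: ifP => _; case: ifP => _; lia.
  - by rewrite d1 dist00 r0 leq0n ltxx.
  - by rewrite d1 dist00 r0 leq0n ltxx.
split=> [s s0 /(_ 0%N)|]; first by rewrite s0; apply: st.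
exists (pulse f0 n r); split=> // L' KL' _.
by case: (clos_rt_rt1n _ _ _ _ KL') => // y z /st.
Qed.

(* Main.v *)
Require Import Defs.
From mathcomp Require Import all_boot.
From mathcomp Require Import order ssralg ssrnum ssrint finmap zify.
From Stdlib Require Import Relation_Operators Operators_Properties.
From Stdlib Require Import Classical ClassicalEpsilon.

(* Put m = floor(n/2) and let z be the face at height r + m above f0. A
   1-Lipschitz function that lies above (below) a configuration and is at least
   (at most) n next to f0 stays above (below) it under firing. Flattening the
   column of f0 above f0 on its own puts a chip on z, by a mass count, and that
   chip never leaves: the indicator of z is a lower barrier. Flattening instead
   the rows at the upper tip of the pulse, each on its own, brings the
   configuration below the function f |-> dist(f, z), again by a mass count;
   this is an upper barrier because r > ceil(n/2) puts the neighbours of f0 at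
   distance at least n from z. Hence z stays empty, and the two outcomes
   differ. *)

Section Firing.

Set Implicit Arguments.
Unset Strict Implicit.
Unset Printing Implicit Defensive.
Import Order.TTheory GRing.Theory Num.Theory.
Local Open Scope ring_scope.

(** Otherwise choice builds an infinite sequence of [S]-steps from [x], and prepending the [R]-path
    from [x0] contradicts the hypothesis on [x0]. It serves twice: with [S] a confined firing it
    flattens a region, with [S] equal to [R] it runs on to a stable configuration. *)
Lemma stuck_exists (T : Type) (R S : T -> T -> Prop) (x0 x : T) :
  (forall s : nat -> T, s 0%N = x0 -> ~ forall i, R (s i) (s i.+1)) ->
  clos_refl_trans T R x0 x -> (forall y z, S y z -> R y z) ->
  exists2 y, clos_refl_trans T S x y & forall z, ~ S y z.
Proof.
move=> fin0 x0x SR.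
have fin : forall s : nat -> T, s 0%N = x -> ~ forall i, R (s i) (s i.+1).
  elim: (clos_rt_rtn1 _ _ _ _ x0x) => // u v uv _ IH s s0 sR.
  by apply: (IH (fun i => if i is j.+1 then s j else u)) => // -[|i] //=; rewrite s0.
apply: NNPP => noy.
have step (y : {y | clos_refl_trans T S x y}) :
    {z : {z | clos_refl_trans T S x z} | S (sval y) (sval z)}.
  apply: constructive_indefinite_description; apply: NNPP => noz; apply: noy.
  case: y noz => y xy noz; exists y => // z yz; apply: noz.
  have xz : clos_refl_trans T S x z by apply: rt_trans xy _; apply: rt_step.
  by exists (exist _ z xz).
pose s i := iter i (fun y => sval (step y)) (exist _ x (rt_refl _ _ _)).
apply: (fin (fun i => sval (s i))) => // i.
by apply: SR; rewrite /s iterS; case: (step _).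
Qed.

Implicit Types (f g x z : face) (K L : config).

(** * Single moves and Lipschitz barriers *)

Lemma adjacent_sym f g : adjacent f g = adjacent g f.
Proof. by rewrite /adjacent !(eq_sym f.1) !(eq_sym f.2) !(distrC f.1) !(distrC f.2). Qed.

Lemma adjacent_neq f g : adjacent f g -> f != g.
Proof. by apply: contraTneq => ->; rewrite /adjacent !subrr normr0 !andbF. Qed.

Lemma fire_betweenE (K : config) f g x : f != g ->
  [fsfun K with f |-> K f - 1, g |-> K g + 1]%fsfun x =
  K x - (x == f)%:R + (x == g)%:R.
Proof.
move=> fg; rewrite fsfun_withE /=; case: (eqVneq x f) => [->|xf].
  by rewrite (negPf fg) addr0.
by rewrite fsfun_withE; case: eqP => [->|_]; rewrite subr0 ?addr0.
Qed.

Lemma fire_marked f0 (K K' : config) : fire f0 K K' -> K' f0 = K f0.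
Proof.
case=> [f g fg ff0 gf0 _|g /adjacent_neq/negPf f0g _|g /adjacent_neq/negPf f0g _].
- rewrite fire_betweenE ?(adjacent_neq fg) //.
  by rewrite !(eq_sym f0) (negPf ff0) (negPf gf0) subr0 addr0.
- by rewrite fsfun_withE f0g.
- by rewrite fsfun_withE f0g.
Qed.

(** Only a face [g] that gains a chip matters. If [f] fires towards it, then
    [K g + 1 <= K f - 1 <= B f - 1 <= B g]; if [f0] does, then [K g < K f0 <= B g]. *)
Lemma fire_upper_barrier f0 (B : face -> int) (K K' : config) :
  (forall f g, adjacent f g -> B f <= B g + 1) ->
  (forall g, adjacent f0 g -> K f0 <= B g) ->
  fire f0 K K' -> (forall f, K f <= B f) -> forall f, K' f <= B f.
Proof.
move=> lipB innerB KK' leB x.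
case: KK' => [f g fg ff0 gf0 KgK|g f0g KgK|g f0g KgK].
- rewrite fire_betweenE ?(adjacent_neq fg) //.
  have := leB x; have := leB f; have := lipB _ _ fg.
  by case: (eqVneq x g) => [->|_]; case: eqP => _ /=; lia.
- rewrite fsfun_withE; have := leB x; have := innerB _ f0g.
  by case: (eqVneq x g) => [->|_]; lia.
- rewrite fsfun_withE; have := leB x.
  by case: (eqVneq x g) => [->|_]; lia.
Qed.

Lemma fire_lower_barrier f0 (B : face -> int) (K K' : config) :
  (forall f g, adjacent f g -> B f <= B g + 1) ->
  (forall g, adjacent f0 g -> B g <= K f0) ->
  fire f0 K K' -> (forall f, B f <= K f) -> forall f, B f <= K' f.
Proof.
move=> lipB innerB KK' leB x.
case: KK' => [f g fg ff0 gf0 KgK|g f0g KgK|g f0g KgK].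
- rewrite fire_betweenE ?(adjacent_neq fg) //.
  have := leB x; have := leB g; have := lipB _ _ fg.
  by case: (eqVneq x f) => [->|_]; case: eqP => _ /=; lia.
- rewrite fsfun_withE; have := leB x.
  by case: (eqVneq x g) => [->|_]; lia.
- rewrite fsfun_withE; have := leB x; have := innerB _ f0g.
  by case: (eqVneq x g) => [->|_]; lia.
Qed.

Lemma star_marked f0 (K K' : config) : fire_star f0 K K' -> K' f0 = K f0.
Proof.
by elim=> [? ? /fire_marked //| // |u v w _ uv _ vw]; rewrite vw uv.
Qed.

Lemma star_upper_barrier f0 (B : face -> int) (K K' : config) :
  (forall f g, adjacent f g -> B f <= B g + 1) ->
  (forall g, adjacent f0 g -> K f0 <= B g) ->
  fire_star f0 K K' -> (forall f, K f <= B f) -> forall f, K' f <= B f.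
Proof.
move=> lipB innerB KK'.
elim: (clos_rt_rtn1 _ _ _ _ KK') => // u v uv Ku IH leB.
have {}Ku := clos_rtn1_rt _ _ _ _ Ku.
apply: fire_upper_barrier uv (IH leB) => // g.
by rewrite (star_marked Ku); apply: innerB.
Qed.

Lemma star_lower_barrier f0 (B : face -> int) (K K' : config) :
  (forall f g, adjacent f g -> B f <= B g + 1) ->
  (forall g, adjacent f0 g -> B g <= K f0) ->
  fire_star f0 K K' -> (forall f, B f <= K f) -> forall f, B f <= K' f.
Proof.
move=> lipB innerB KK'.
elim: (clos_rt_rtn1 _ _ _ _ KK') => // u v uv Ku IH leB.
have {}Ku := clos_rtn1_rt _ _ _ _ Ku.
apply: fire_lower_barrier uv (IH leB) => // g.
by rewrite (star_marked Ku); apply: innerB.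
Qed.

(** * Firing confined to a list of faces *)

Inductive fire_within (A : seq face) (K : config) : config -> Prop :=
| FireWithin f g : f \in A -> g \in A -> adjacent f g -> K g + 2 <= K f ->
    fire_within A K [fsfun K with f |-> K f - 1, g |-> K g + 1]%fsfun.

Lemma fire_within_mass (A : seq face) (K K' : config) : uniq A ->
  fire_within A K K' -> \sum_(f <- A) K' f = \sum_(f <- A) K f.
Proof.
move=> uA [f g fA gA fg _].
have sum1 h : h \in A -> \sum_(x <- A) (x == h)%:R = 1 :> int.
  move=> hA; rewrite (bigD1_seq h) //= eqxx big1 ?addr0 // => x.
  by move/negPf->.
under eq_bigr do rewrite fire_betweenE ?(adjacent_neq fg) //.
by rewrite big_split sumrB /= !sum1 // subrK.
Qed.

(** Moves confined to [A] avoid [f0], so they are legal firings that conserve mass and exchange no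
    chips with the outside; the Lipschitz bound says that none of them is left. *)
Lemma stabilize_within f0 (A : seq face) (K0 K : config) :
  (forall s : nat -> config,
     s 0%N = K0 -> ~ forall i, fire f0 (s i) (s i.+1)) ->
  fire_star f0 K0 K -> uniq A -> f0 \notin A ->
  exists K' : config, [/\ fire_star f0 K K',
    forall f, f \notin A -> K' f = K f,
    \sum_(f <- A) K' f = \sum_(f <- A) K f &
    forall f g, f \in A -> g \in A -> adjacent f g -> K' f <= K' g + 1].
Proof.
move=> fin K0K uA f0A.
have sub u v : fire_within A u v -> fire f0 u v.
  case=> f g fA gA fg guf; apply: FireBetween => //.
    by apply: contraNneq f0A => <-.
  by apply: contraNneq f0A => <-.
have [K' KK' stuck] := stuck_exists fin K0K sub.
have {}KK' := clos_rt_rtn1 _ _ _ _ KK'.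
exists K'; split; last first.
- move=> f g fA gA fg; case: (lerP (K' f) (K' g + 1)) => // lt; exfalso.
  by apply: stuck; apply: (FireWithin fA gA fg); lia.
- by elim: KK' => // u v uv _ <-; rewrite (fire_within_mass uA uv).
- elim: KK' => // u v [f g fA gA fg _] _ IH x xA.
  rewrite fire_betweenE ?(adjacent_neq fg) // IH //.
  have -> : (x == f) = false by apply: contraNF xA => /eqP->.
  have -> : (x == g) = false by apply: contraNF xA => /eqP->.
  by rewrite subr0 addr0.
- elim: KK' => [|u v /sub uv _ Ku]; first exact: rt_refl.
  by apply: rt_trans Ku _; apply: rt_step.
Qed.

(** * Mass of one-dimensional Lipschitz profiles *)

Lemma triangle_mass (c : nat) :
  (\sum_(0 <= j < c) (c - j)%N%:Z) * 2 = (c * c.+1)%N%:Z.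
Proof.
elim: c => [|c IH]; first by rewrite big_geq.
rewrite big_nat_recl //= mulrDl; under eq_bigr do rewrite subSS.
by rewrite IH; lia.
Qed.

(** A pyramid fits under the peak: c, c-1, ..., 1 from [i] to the right and c-1, ..., 1 to its left,
    of total mass c(c+1)/2 + c(c-1)/2 = c^2. *)
Lemma peak_mass (v : nat -> int) (N i c : nat) :
  (forall j, (j < N)%N -> 0 <= v j) ->
  (forall j, (j.+1 < N)%N -> v j <= v j.+1 + 1) ->
  (forall j, (j.+1 < N)%N -> v j.+1 <= v j + 1) ->
  (c <= i.+1)%N -> (i + c <= N)%N -> (0 < c)%N -> c%:Z <= v i ->
  (c * c)%N%:Z <= \sum_(0 <= j < N) v j.
Proof.
move=> v0 vr vl ci icN c0 cv.
have right j : (j < c)%N -> c%:Z - j%:Z <= v (i + j)%N.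
  elim: j => [|j IH] jc; first by rewrite addn0; lia.
  have := IH (ltnW jc); have := vr (i + j)%N; rewrite addnS => /(_ ltac:(lia)); lia.
have left j : (j < c)%N -> c%:Z - j%:Z <= v (i - j)%N.
  elim: j => [|j IH] jc; first by rewrite subn0; lia.
  have := IH (ltnW jc); have := vl (i - j.+1)%N.
  have -> : (i - j.+1).+1 = (i - j)%N by lia.
  by move=> /(_ ltac:(lia)); lia.
have nonneg a b : (b <= N)%N -> 0 <= \sum_(a <= j < b) v j.
  move=> bN; rewrite big_nat; apply: sumr_ge0 => j /andP[_ jb].
  by apply: v0; lia.
have hi : \sum_(0 <= j < c) (c - j)%N%:Z <= \sum_(i <= j < i + c) v j.
  rewrite -{1}[i]add0n big_addn addKn.
  rewrite !big_nat; apply: ler_sum => j /andP[_ jc].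
  by rewrite addnC; have := right j jc; lia.
have lo : \sum_(0 <= j < c.-1) (c.-1 - j)%N%:Z <= \sum_(i.+1 - c <= j < i) v j.
  rewrite [X in _ <= X]big_nat_rev /=.
  rewrite -{1}[(i.+1 - c)%N]add0n big_addn.
  have -> : (i - (i.+1 - c) = c.-1)%N by lia.
  rewrite !big_nat; apply: ler_sum => j /andP[_ jc].
  have -> : (i.+1 - c + i - (j + (i.+1 - c)).+1 = i - j.+1)%N by lia.
  by have := left j.+1 ltac:(lia); lia.
rewrite (big_cat_nat (leq0n (i.+1 - c)%N)) /=; last by lia.
rewrite (@big_cat_nat _ _ _ i (i.+1 - c)) /=; [|lia|lia].
rewrite (@big_cat_nat _ _ _ (i + c) i) /=; [|lia|lia].
have := triangle_mass c; have := triangle_mass c.-1.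
have := nonneg 0%N (i.+1 - c)%N ltac:(lia).
have := nonneg (i + c)%N N ltac:(lia).
move: hi lo; move: (\sum_(0 <= j < _) _) => S1; move: (\sum_(i <= j < _) _) => S2.
move: (\sum_(0 <= j < c.-1) _) => S3; move: (\sum_(_ <= j < i) _) => S4.
move: (\sum_(_ <= j < N) _) => S5; move: (\sum_(0 <= j < _) _) => S6.
have [d ->] : exists d, c = d.+1 by exists c.-1; lia.
by move=> /=; nia.
Qed.

(** [minn n j] is the largest profile, counted from the outer end, of a flattened column with
    heights at most [n] and an empty outer end. *)
Lemma slope_mass (n t : nat) :
  (\sum_(0 <= j < n + t) (minn n j)%:Z) * 2 = (n * n.-1 + 2 * (n * t))%N%:Z.
Proof.
elim: t => [|t IH].
  rewrite addn0 muln0 muln0 addn0.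
  have -> : \sum_(0 <= j < n) (minn n j)%:Z = \sum_(0 <= j < n) j%:Z.
    by apply: eq_big_nat => j /andP[_ jn]; congr (_%:Z); apply/minn_idPr; lia.
  elim: n => [|n IH]; first by rewrite big_geq.
  by rewrite big_nat_recr //= mulrDl IH; case: n {IH} => //= n; lia.
rewrite addnS big_nat_recr //= mulrDl IH.
have /minn_idPl -> : (n <= n + t)%N by lia.
lia.
Qed.

(** * Flattening the column above the marked face *)

Lemma pulse_star_bounds f0 n r (K : config) f :
  fire_star f0 (pulse f0 n r) K -> 0 <= K f <= n%:Z.
Proof.
move=> PK; have P0 : pulse f0 n r f0 = n%:Z by rewrite pulseE /dist !subrr.
apply/andP; split.
  apply: (star_lower_barrier (B := fun=> 0)) PK _ f => // [g _|g]; rewrite ?P0 // pulseE.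
  by case: ifP.
apply: (star_upper_barrier (B := fun=> n%:Z)) PK _ f => // [g h _|g _|g];
  rewrite ?P0 ?pulseE; try lia.
by case: ifP.
Qed.

(** With M = r + floor(n/2), a flattened column with empty top has mass at most n(n-1)/2 + n(M-n) =
    n(M - (n+1)/2). The pulse puts n r = n(M - floor(n/2)) on it, which is strictly more. *)
Lemma column_reach f0 n r :
  (forall s : nat -> config, s 0%N = pulse f0 n r ->
     ~ forall i, fire f0 (s i) (s i.+1)) ->
  (0 < n)%N -> (n <= r + n./2)%N ->
  exists2 K : config, fire_star f0 (pulse f0 n r) K &
    1 <= K (f0.1, f0.2 + (r + n./2)%N%:Z).
Proof.
move=> fin n0 nr; set M := (r + n./2)%N.
pose cell (i : nat) : face := (f0.1, f0.2 + i.+1%:Z).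
pose A := map cell (index_iota 0 M).
have uA : uniq A.
  by rewrite map_inj_uniq ?iota_uniq // => i k []; lia.
have f0A : f0 \notin A.
  by apply/mapP => -[i _]; rewrite /cell; case: (f0) => a b /= []; lia.
have cellA i : (i < M)%N -> cell i \in A.
  by move=> iM; rewrite map_f // mem_index_iota.
have [K [PK _ massK lipK]] := stabilize_within fin (rt_refl _ _ _) uA f0A.
exists K => //; case: (lerP 1) => // top; exfalso.
have slope j : (j < M)%N -> K (cell (M.-1 - j)%N) <= j%:Z.
  elim: j => [|j IH] jM.
    by rewrite subn0 /cell (ltn_predK jM); lia.
  have := lipK (cell (M.-1 - j.+1)%N) (cell (M.-1 - j)%N).
  move=> /(_ (cellA (M.-1 - j.+1)%N ltac:(lia)) (cellA (M.-1 - j)%N ltac:(lia))).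
  have -> : adjacent (cell (M.-1 - j.+1)%N) (cell (M.-1 - j)%N).
    by rewrite /adjacent /=; lia.
  by have := IH (ltnW jM); move=> h /(_ isT); lia.
move: massK; rewrite !big_map.
have -> : \sum_(j <- index_iota 0 M) pulse f0 n r (cell j) = (n * r)%N%:Z.
  rewrite (big_cat_nat (leq0n r)) /=; last by lia.
  have -> : \sum_(r <= i < M) pulse f0 n r (cell i) = 0.
    rewrite big_nat big1 // => i /andP[ri _].
    by rewrite pulseE /dist /=; case: ifP => //; lia.
  rewrite addr0.
  transitivity (\sum_(0 <= i < r) n%:Z).
    by apply: eq_big_nat => i /andP[_ ir]; rewrite pulseE /dist /=; case: ifP => //; lia.
  by rewrite sumr_const_nat subn0; lia.
rewrite big_nat_rev /= add0n => massK.
have : \sum_(0 <= j < M) K (cell (M - j.+1)%N) <= \sum_(0 <= j < M) (minn n j)%:Z.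
  rewrite !big_nat; apply: ler_sum => j /andP[_ jM].
  have := slope j jM; have /andP[_] := pulse_star_bounds (cell (M - j.+1)%N) PK.
  have -> : (M - j.+1 = M.-1 - j)%N by lia.
  by lia.
rewrite massK; have [t Mt] : exists t, M = (n + t)%N by exists (M - n)%N; lia.
rewrite Mt; have := slope_mass n t; move: (\sum_(_ <= j < _) _) => S SE nrS.
have rE : r = (n + t - n./2)%N by lia.
have : (n * r).*2%:Z <= (n * n.-1 + 2 * (n * t))%N%:Z by lia.
(* Here [d] is ceil(n/2). For odd [n] the strict bound is plain; for even [n] it fails by itself and
   holds only because the estimates on [S] are already contradictory. *)
have [d [dE dn]] : exists d, r = (d + t)%N /\ (n < d.*2)%N by exists (n - n./2)%N; lia.
have : (n.-1 < d.*2)%N by lia.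
rewrite dE; nia.
Qed.

(** * Flattening the rows at the upper tip of the pulse *)

Lemma flatten_row f0 (K0 K : config) (n c : nat) (y : int) :
  (forall s : nat -> config,
     s 0%N = K0 -> ~ forall i, fire f0 (s i) (s i.+1)) ->
  fire_star f0 K0 K -> (forall f, 0 <= K f) -> y != f0.2 -> (c <= n)%N ->
  \sum_(0 <= i < (4 * n).+1) K (f0.1 - (2 * n)%N%:Z + i%:Z, y) < (c.+1 * c.+1)%N%:Z ->
  exists K' : config, [/\ fire_star f0 K K',
    forall f, f.2 != y -> K' f = K f &
    forall f, f.2 = y -> `|f.1 - f0.1| <= n%:Z -> K' f <= c%:Z].
Proof.
move=> fin K0K K_ge0 yf0 cn massK.
(* The window reaches 2n to either side, so a face within n of the centre has n more cells on each
   side: room for the whole pyramid under a peak of height [c.+1], whose mass exceeds that of the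
   row. *)
pose cell (i : nat) : face := (f0.1 - (2 * n)%N%:Z + i%:Z, y).
pose A := map cell (index_iota 0 (4 * n).+1).
have uA : uniq A.
  by rewrite map_inj_uniq ?iota_uniq // => i k []; lia.
have f0A : f0 \notin A.
  by apply: contra yf0 => /mapP[i _ ->].
have cellA i : (i < (4 * n).+1)%N -> cell i \in A.
  by move=> iM; rewrite map_f // mem_index_iota.
have [K' [KK' offK' massK' lipK']] := stabilize_within fin K0K uA f0A.
exists K'; split=> // [f fy|[x _] /= -> xn].
  by apply: offK'; apply: contra fy => /mapP[i _ ->].
case: lerP => // ltc; exfalso.
move: massK'; rewrite !big_map => massK'.
have adj j : adjacent (cell j) (cell j.+1) by rewrite /adjacent /=; lia.
have [i [ilo ihi xE]] : exists i : nat,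
    [/\ (n <= i)%N, (i <= 3 * n)%N & x = f0.1 - (2 * n)%N%:Z + i%:Z].
  by exists (absz (x - f0.1 + (2 * n)%N%:Z)); split; lia.
move: massK; rewrite ltNge => /negP[]; rewrite -[X in _ <= X]massK'.
apply: (@peak_mass (fun j => K' (cell j)) (4 * n).+1 i c.+1);
  rewrite ?ltnS //; try lia.
- by move=> j _; apply: (star_lower_barrier (B := fun=> 0) _ _ KK' K_ge0).
- by move=> j jn; apply: lipK'; rewrite ?cellA // ltnW.
- by move=> j jn; apply: lipK'; rewrite ?cellA 1?adjacent_sym // ltnW.
- by move: ltc; rewrite /cell -xE; move: (K' _) => w; lia.
Qed.

Lemma pulse_row_mass f0 (n r k : nat) : (k <= n)%N -> (k <= r)%N ->
  \sum_(0 <= i < (4 * n).+1)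
     pulse f0 n r (f0.1 - (2 * n)%N%:Z + i%:Z, f0.2 + (r - k)%N%:Z) =
  ((2 * k).+1 * n)%N%:Z.
Proof.
move=> kn kr.
have out a b : (b <= 2 * n - k)%N || (2 * n + k < a)%N ->
    \sum_(a <= i < b) pulse f0 n r
       (f0.1 - (2 * n)%N%:Z + i%:Z, f0.2 + (r - k)%N%:Z) = 0.
  move=> ab; rewrite big_nat big1 // => i /andP[ai ib].
  by rewrite pulseE /dist /=; case: ifP => //; lia.
rewrite (big_cat_nat (leq0n (2 * n - k)%N)) /=; last by lia.
rewrite (@big_cat_nat _ _ _ (2 * n + k).+1 (2 * n - k)) /=; [|lia|lia].
rewrite (out 0%N) ?leqnn // (out (2 * n + k).+1) ?ltnSn ?orbT // add0r addr0.
transitivity (\sum_(2 * n - k <= i < (2 * n + k).+1) n%:Z).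
  apply: eq_big_nat => i /andP[ilo ihi].
  by rewrite pulseE /dist /=; case: ifP => //; lia.
rewrite sumr_const_nat.
have -> : ((2 * n + k).+1 - (2 * n - k) = (2 * k).+1)%N by lia.
by lia.
Qed.

(** Rows are treated from the top down, so each still has its pulse mass when its turn comes. The
    bound on a row is the distance from its middle face to the face at height r + floor(n/2) above
    [f0]. *)
Lemma flatten_rows f0 (n r j : nat) :
  (forall s : nat -> config, s 0%N = pulse f0 n r ->
     ~ forall i, fire f0 (s i) (s i.+1)) ->
  (uphalf n < r)%N -> (j <= n./2)%N ->
  exists K : config, [/\ fire_star f0 (pulse f0 n r) K,
    forall f, (f.2 <= f0.2 + r%:Z - j%:Z) || (f0.2 + r%:Z < f.2) ->
      K f = pulse f0 n r f &
    forall f, f0.2 + r%:Z - j%:Z < f.2 <= f0.2 + r%:Z ->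
      `|f.1 - f0.1| <= n%:Z -> K f <= (n./2)%:Z + (f0.2 + r%:Z - f.2)].
Proof.
move=> fin nr; elim: j => [|j IH] jn.
  exists (pulse f0 n r); split=> //; first exact: rt_refl.
  by move=> f; lia.
have [K [PK offK lowK]] := IH (ltnW jn).
have K_ge0 f : 0 <= K f by have /andP[] := pulse_star_bounds f PK.
have [|||K' [KK' offK' lowK']] :=
  @flatten_row f0 _ K n (n./2 + j)%N (f0.2 + (r - j)%N%:Z) fin PK K_ge0.
- by lia.
- by lia.
- have rowE i : K (f0.1 - (2 * n)%N%:Z + i%:Z, f0.2 + (r - j)%N%:Z) =
      pulse f0 n r (f0.1 - (2 * n)%N%:Z + i%:Z, f0.2 + (r - j)%N%:Z).
    by apply: offK => /=; lia.
  under eq_bigr do rewrite rowE.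
  rewrite pulse_row_mass; [|lia|lia].
  rewrite ltz_nat.
  (* This is AM-GM for 2j+1 and 2 floor(n/2) + 1, whose mean is floor(n/2) + j + 1; it is strict
     because j < floor(n/2). *)
  have [d dE] : exists d, n./2 = (j.+1 + d)%N by exists (n./2 - j.+1)%N; lia.
  have nle : (n <= (n./2).*2.+1)%N by lia.
  apply: (leq_ltn_trans (leq_mul (leqnn _) nle)); rewrite dE -muln2.
  by clear; nia.
exists K'; split; first by apply: rt_trans PK KK'.
  move=> f fj; rewrite offK'; first by apply: offK; lia.
  by apply/eqP => fE; move: fj; rewrite fE; lia.
move=> f fj fn; case: (eqVneq f.2 (f0.2 + (r - j)%N%:Z)) => [fE|fE].
  by have := lowK' f fE fn; lia.
by rewrite offK' //; apply: lowK => //; lia.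
Qed.

Lemma tip_avoid f0 (n r : nat) (z := (f0.1, f0.2 + (r + n./2)%N%:Z)) :
  (forall s : nat -> config, s 0%N = pulse f0 n r ->
     ~ forall i, fire f0 (s i) (s i.+1)) ->
  (1 < n)%N -> (uphalf n < r)%N ->
  exists2 K : config, fire_star f0 (pulse f0 n r) K &
    forall f, K f <= (dist f z)%:Z.
Proof.
move=> fin n1 nr; have m0 : (0 < n./2)%N by lia.
have zE f : dist f z =
    (absz (f.1 - f0.1)%R + absz (f.2 - (f0.2 + (r + n./2)%N%:Z))%R)%N by [].
have [K [PK offK lowK]] := flatten_rows fin nr (leqnn _).
have bndK f := pulse_star_bounds f PK.
have [n2|n2] : n = (n./2 + n./2)%N \/ n = (n./2 + n./2).+1 by lia.
  exists K => // f; rewrite zE.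
  have := bndK f; have := lowK f; have := offK f; rewrite pulseE [dist f0 f]/dist.
  move: (K f) => v off low /andP[_ vn].
  (* Far columns and rows up to height r - n/2 are at distance at least n from [z], where the bound
     n suffices; the rows above them up to height r are flattened, and higher ones are empty. *)
  have [far|near] := ltrP n%:Z `|f.1 - f0.1|; first by lia.
  have [lo|hi] := lerP f.2 (f0.2 + r%:Z - (n./2)%:Z); first by lia.
  have [top|out] := lerP f.2 (f0.2 + r%:Z).
    by move: low; rewrite hi top => /(_ isT near); lia.
  by rewrite off ?out ?orbT //; case: ifP => //; lia.
(* For odd n the mass of row y is exactly n^2, which still allows a peak of
   height n; firing one chip from f up to g before flattening rules it out. *)
pose y := f0.2 + (r - n./2)%N%:Z.
pose f : face := (f0.1 + (n./2)%:Z, y).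
pose g : face := (f0.1 + (n./2)%:Z, y + 1).
have fg : adjacent f g by rewrite /adjacent /f /g /=; lia.
have Kf : K f = n%:Z.
  by rewrite offK /f /y /= ?pulseE ?/dist /=; [case: ifP => //; lia|lia].
(* [g] lies in the lowest flattened row, whose bound is 2 floor(n/2) - 1 = n - 2 for odd n; so
   firing [f] towards [g] is legal. *)
have Kg : K g <= n%:Z - 2.
  by have := lowK g; rewrite /g /y /=; move: (K _) => v; lia.
pose K1 : config := [fsfun K with f |-> K f - 1, g |-> K g + 1]%fsfun.
have K1E x : K1 x = K x - (x == f)%:R + (x == g)%:R.
  by rewrite fire_betweenE ?(adjacent_neq fg).
have PK1 : fire_star f0 (pulse f0 n r) K1.
  apply: rt_trans PK _; apply: rt_step; apply: FireBetween => //; last by lia.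
  - by apply/eqP => /(congr1 snd); rewrite /f /y /=; lia.
  - by apply/eqP => /(congr1 snd); rewrite /g /y /=; lia.
have K1_ge0 x : 0 <= K1 x by have /andP[] := pulse_star_bounds x PK1.
have [|||K' [KK' offK' lowK']] :=
  @flatten_row f0 _ K1 n (n./2).*2 y fin PK1 K1_ge0.
- by rewrite /y; lia.
- by lia.
- have rowE i : K1 (f0.1 - (2 * n)%N%:Z + i%:Z, y) =
      pulse f0 n r (f0.1 - (2 * n)%N%:Z + i%:Z, y) - (i == 2 * n + n./2)%N%:R.
    rewrite K1E offK /=; last by rewrite /y; lia.
    rewrite /f /g !xpair_eqE eqxx andbT.
    have -> : (y == y + 1) = false by lia.
    rewrite andbF addr0; congr (_ - _%:R); congr (nat_of_bool _).
    by apply/eqP/eqP; lia.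
  under eq_bigr do rewrite rowE.
  rewrite sumrB pulse_row_mass; [|lia|lia].
  rewrite (bigD1_seq (2 * n + n./2)%N) ?iota_uniq ?mem_index_iota /=; [|lia|done].
  rewrite eqxx big1 => [|i /negPf->//].
  have -> : ((n./2).*2.+1 = n)%N by lia.
  have -> : ((2 * n./2).+1 = n)%N by lia.
  by rewrite addr0; nia.
exists K'; first by apply: rt_trans PK1 KK'.
move=> x; rewrite zE; have PK' := rt_trans _ _ _ _ _ PK1 KK'.
have := pulse_star_bounds x PK'; have := offK' x; have := lowK' x.
move: (K' x) => v low' off' /andP[_ vn].
have [far|near] := ltrP n%:Z `|x.1 - f0.1|; first by lia.
have [lo|hi] := ltrP x.2 y; first by move: lo; rewrite /y; lia.
have [xy|xy] := eqVneq x.2 y.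
  by have := low' xy near; move: xy; rewrite /y; lia.
rewrite off' // K1E.
have -> : (x == f) = false by apply: contraNF xy => /eqP ->.
(* [g] may now hold n - 1 = 2 floor(n/2) chips. Being off centre by floor(n/2), it is at distance 3
   floor(n/2) - 1 from [z], which absorbs the extra chip. *)
have [->|xg] := eqVneq x g; first by move: Kg; rewrite /g /y /=; move: (K _) => w; lia.
have := lowK x; have := offK x; rewrite pulseE [dist f0 x]/dist.
move: (K x) => w off low; rewrite subr0 addr0.
have [top|out] := lerP x.2 (f0.2 + r%:Z).
  move: low; rewrite top andbT => /(_ _ near).
  by move: xy hi; rewrite /y => xy hi /(_ ltac:(lia)); lia.
by rewrite off ?out ?orbT //; case: ifP => //; lia.
Qed.

(** * Incompatibility of the two outcomes *)

Lemma dist_lipschitz (z f g : face) :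
  adjacent f g -> (dist f z)%:Z <= (dist g z)%:Z + 1.
Proof. by rewrite /adjacent /dist => /orP[] /andP[/eqP-> /eqP]; lia. Qed.

Lemma incompatible_outcomes f0 (n r : nat) :
  (forall s : nat -> config, s 0%N = pulse f0 n r ->
     ~ forall i, fire f0 (s i) (s i.+1)) ->
  (1 < n)%N -> (uphalf n < r)%N ->
  exists K1 K2 : config,
    [/\ fire_star f0 (pulse f0 n r) K1, fire_star f0 (pulse f0 n r) K2 &
        forall L, fire_star f0 K1 L -> ~ fire_star f0 K2 L].
Proof.
move=> fin n1 nr; pose z : face := (f0.1, f0.2 + (r + n./2)%N%:Z).
have markedE K : fire_star f0 (pulse f0 n r) K -> K f0 = n%:Z.
  by move=> /star_marked ->; rewrite pulseE /dist !subrr.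
have [K1 PK1 leK1] := tip_avoid fin n1 nr.
have [K2 PK2 K2z] := column_reach fin (ltnW n1) ltac:(lia).
exists K1, K2; split=> // L K1L K2L.
have : L z <= (dist z z)%:Z.
  apply: (star_upper_barrier _ _ K1L leK1) => [f g|g].
    exact: dist_lipschitz.
  (* The neighbour of [f0] nearest to [z] is at distance r + floor(n/2) - 1, which is at least n
     exactly when r > ceil(n/2). *)
  rewrite (markedE _ PK1) /adjacent /dist /=.
  by move=> /orP[] /andP[/eqP <- /eqP]; lia.
have : (z == z)%:Z <= L z.
  apply: (star_lower_barrier (B := fun f => (f == z)%:Z) _ _ K2L).
  - by move=> f g _; case: eqP; case: eqP.
  - by move=> g _; rewrite (markedE _ PK2); case: eqP => _ /=; lia.
  - move=> f; have /andP[Kf0 _] := pulse_star_bounds f PK2.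
    by case: eqP => [->|_].
by rewrite eqxx /dist !subrr; move: (L z) => v; lia.
Qed.

End Firing.

Theorem theorem6p1 (f0 : face) (n r : nat) (hn : 1 < n) (hr : uphalf n < r) :
  ~ terminates_uniquely f0 (pulse f0 n r).
Proof.
move=> [fin [L [_ uniqL]]].
(* Every reachable configuration runs on to a stable one, which uniqueness identifies with [L]; so
   [L] would lie beyond both incompatible outcomes. *)
have toL K : fire_star f0 (pulse f0 n r) K -> fire_star f0 K L.
  move=> PK; have [K' KK' stK'] := stuck_exists fin PK (fun _ _ => id).
  by rewrite -(uniqL K') //; apply: rt_trans PK KK'.
have [K1 [K2 [PK1 PK2 disjoint]]] := incompatible_outcomes fin hn hr.
exact: disjoint (toL _ PK1) (toL _ PK2).
Qed.
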